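(* Let $\mathbf{E}=\{E_i\}_{i=1}^n$ be a POVM on a $d$-dimensional Hilbert space $\mathcal H$, and let $\{A_i\}_{i=1}^n$ be operators on $\mathcal H$ with $E_i=A_i^\dagger A_i$ for all $i$. For every state $\rho$ on $\mathcal H$ the relative entropy of POVM-based coherence $C_{\rm rel}(\rho,\mathbf E)$ does not depend on the choice of Naimark extension of $\mathbf E$ used to define it, and $$C_{\rm rel}(\rho,\mathbf E)=H(\{p_i(\rho)\})+\sum_{i=1}^n p_i(\rho)\,S(\rho_i)-S(\rho),$$ where $p_i(\rho)=\operatorname{tr}[E_i\rho]$, $\rho_i=\frac1{p_i(\rho)}A_i\rho A_i^\dagger$ (terms with $p_i(\rho)=0$ are taken to be $0$), and $H(\{p_i\})=-\sum_i p_i\log p_i$. In the special case where $\mathbf E$ is a von Neumann measurement, i.e. $E_i=|i\rangle\langle i|$ for an orthonormal basis $\{|i\rangle\}$ of $\mathcal H$, $C_{\rm rel}(\rho,\mathbf E)$ equals the standard relative entropy of coherence of $\rho$ with respect to this basis, $S\big(\sum_i |i\rangle\langle i|\rho|i\rangle\langle i|\big)-S(\rho)$.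
   Context: All Hilbert spaces are finite-dimensional. A state on $\mathcal H$ is a positive semidefinite operator of trace one. A POVM on $\mathcal H$ with $n$ outcomes is a set $\{E_i\}_{i=1}^n$ of positive semidefinite operators with $\sum_i E_i=\mathbb 1$. A projective measurement is a POVM $\{P_i\}$ with $P_iP_j=\delta_{ij}P_i$ (projectors of arbitrary rank). $S(\rho)=-\operatorname{tr}[\rho\log\rho]$ is the von Neumann entropy and $S(\rho\|\sigma)=\operatorname{tr}[\rho\log\rho-\rho\log\sigma]$ the quantum relative entropy. Naimark extension: a projective measurement $\mathbf P=\{P_i\}_{i=1}^n$ on a Hilbert space $\mathcal H'$ of dimension $d'\ge d$ containing $\mathcal H$ as a direct summand, such that $\operatorname{tr}[E_i\rho]=\operatorname{tr}[P_i(\rho\oplus 0)]$ for all $i$ and all states $\rho$ on $\mathcal H$, where $0$ is the zero operator of dimension $d'-d$. (A special case is the canonical Naimark extension, where $\mathcal H'=\mathcal H\otimes\mathcal H_R$, $\mathcal H$ is identified with $\mathcal H\otimes|1\rangle$ so that $\rho$ is embedded as $\rho\otimes|1\rangle\langle 1|$, and $P_i=V^\dagger(\mathbb 1\otimes|i\rangle\langle i|)V$ for a suitable unitary $V$.) Relative entropy of block coherence of a state $\rho'$ on $\mathcal H'$ with respect to a projective measurement $\mathbf P$: $C_{\rm rel}(\rho',\mathbf P)=\min_{\sigma\in\mathcal I}S(\rho'\|\sigma)=S(\Delta[\rho'])-S(\rho')$, where $\Delta[X]=\sum_iP_iXP_i$ and $\mathcal I$ is the set of states of the form $\Delta[\tau]$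 with $\tau$ a state on $\mathcal H'$. Relative entropy of POVM-based coherence: $C_{\rm rel}(\rho,\mathbf E):=C_{\rm rel}(\rho\oplus 0,\mathbf P)=S(\Delta[\rho\oplus0])-S(\rho)$ for a Naimark extension $\mathbf P$ of $\mathbf E$. *)

(* Defs.v *)
From mathcomp Require Import all_boot all_order all_algebra.
From mathcomp Require Import complex.
From mathcomp Require Import boolp classical_sets reals ereal exp.

Set Implicit Arguments.
Unset Strict Implicit.
Unset Printing Implicit Defensive.

Import Order.TTheory GRing.Theory Num.Theory.

Local Open Scope ring_scope.
Local Open Scope sesquilinear_scope.
Local Open Scope classical_set_scope.
Local Open Scope complex_scope.

(* A [d]-dimensional Hilbert space is R[i]^d, whose vectors
   are columns; operators are matrices, and [A ^t*] is the adjoint. *)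

Definition psdmx (R : realType) (d : nat) (A : 'M[R[i]]_d) : Prop :=
  A ^t* = A /\ forall v : 'cV[R[i]]_d, 0 <= (v ^t* *m A *m v) 0 0.

Definition state (R : realType) (d : nat) (rho : 'M[R[i]]_d) : Prop :=
  psdmx rho /\ \tr rho = 1.

Definition povm (R : realType) (d n : nat) (E : 'I_n -> 'M[R[i]]_d) : Prop :=
  (forall i, psdmx (E i)) /\ \sum_i E i = 1%:M.

Definition projective_measurement (R : realType) (d n : nat)
    (P : 'I_n -> 'M[R[i]]_d) : Prop :=
  povm P /\ forall i j, P i *m P j = if i == j then P i else 0.

Definition orthonormal_basis (R : realType) (d n : nat)
    (u : 'I_n -> 'cV[R[i]]_d) : Prop :=
  (forall i j, (u i) ^t* *m u j = (i == j)%:R%:M) /\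
  (forall v : 'cV[R[i]]_d, exists c : 'I_n -> R[i], v = \sum_i c i *: u i).

(* Spectral calculus for a Hermitian [A] : the library's [spectralmx A] is
   unitary and [A = invmx (spectralmx A) *m diag_mx (spectral_diag A) *m
   spectralmx A].  Since [ln 0 = 0], [logmx A] of a positive semidefinite [A]
   is the logarithm on the support of [A], extended by 0 on its kernel; this
   is the convention 0 log 0 = 0. *)
Definition logmx (R : realType) (d : nat) (A : 'M[R[i]]_d) : 'M[R[i]]_d :=
  invmx (spectralmx A)
    *m diag_mx (map_mx (fun z : R[i] => (ln (complex.Re z))%:C) (spectral_diag A))
    *m spectralmx A.

(* The trace is real when [rho] is Hermitian; [complex.Re] only casts it to R. *)
Definition vn_entropy (R : realType) (d : nat) (rho : 'M[R[i]]_d) : R :=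
  - complex.Re (\tr (rho *m logmx rho)).

(* For Hermitian matrices the inclusion of row spaces [(rho <= sigma)%MS] is the
   inclusion supp rho <= supp sigma of supports (it is its complex conjugate);
   the relative entropy is infinite when it fails. *)
Definition rel_entropy (R : realType) (d : nat) (rho sigma : 'M[R[i]]_d) :
    \bar R :=
  if (rho <= sigma)%MS then
    (complex.Re (\tr (rho *m logmx rho - rho *m logmx sigma)))%:E
  else +oo%E.

Definition shannon_entropy (R : realType) (n : nat) (p : 'I_n -> R) : R :=
  - \sum_i p i * ln (p i).

Definition dephasing (R : realType) (d n : nat) (P : 'I_n -> 'M[R[i]]_d)
    (X : 'M[R[i]]_d) : 'M[R[i]]_d :=
  \sum_i P i *m X *m P i.

Definition block_incoherent (R : realType) (d n : nat)
    (P : 'I_n -> 'M[R[i]]_d) : set 'M[R[i]]_d :=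
  [set dephasing P tau | tau in [set tau | state tau]].

(* For a state [rho] and a projective measurement [P] the infimum is a minimum,
   attained at [dephasing P rho]. *)
Definition block_coherence (R : realType) (d n : nat)
    (P : 'I_n -> 'M[R[i]]_d) (rho : 'M[R[i]]_d) : \bar R :=
  ereal_inf [set rel_entropy rho sigma | sigma in block_incoherent P].

(* The inclusion of R[i]^d in R[i]^d' as an orthogonal direct summand is given
   by an isometry [W]; the operator rho (+) 0 on R[i]^d' is [embed W rho].  See
   [embed_block] for the inclusion of the first [d] coordinates; the embedding
   rho |-> rho (x) |1><1| in a tensor product is another instance. *)
Definition isometry (R : realType) (d d' : nat) (W : 'M[R[i]]_(d', d)) : Prop :=
  W ^t* *m W = 1%:M.

Definition embed (R : realType) (d d' : nat) (W : 'M[R[i]]_(d', d))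
    (X : 'M[R[i]]_d) : 'M[R[i]]_d' :=
  W *m X *m W ^t*.

Lemma embed_block (R : realType) (d k : nat) (X : 'M[R[i]]_d) :
  isometry (col_mx 1%:M 0 : 'M[R[i]]_(d + k, d)) /\
  embed (col_mx 1%:M 0 : 'M[R[i]]_(d + k, d)) X = block_mx X 0 0 0.
Proof.
have WE : (col_mx 1%:M 0 : 'M[R[i]]_(d + k, d)) ^t* = row_mx 1%:M 0.
  by rewrite tr_col_mx map_row_mx trmx1 map_mx1 trmx0 map_mx0.
split; first by rewrite /isometry WE mul_row_col mul1mx mulmx0 addr0.
rewrite /embed WE mul_col_mx mul1mx mul0mx mul_col_row.
by rewrite mulmx1 mulmx0 mul0mx mul0mx.
Qed.

Definition naimark_extension (R : realType) (d n d' : nat)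
    (E : 'I_n -> 'M[R[i]]_d) (W : 'M[R[i]]_(d', d))
    (P : 'I_n -> 'M[R[i]]_d') : Prop :=
  [/\ isometry W, projective_measurement P &
      forall (i : 'I_n) (rho : 'M[R[i]]_d), state rho ->
        \tr (E i *m rho) = \tr (P i *m embed W rho)].

(* The block coherence of rho (+) 0 for some chosen Naimark extension of [E];
   the default value 0 would only be used if [E] had no Naimark extension. *)
Definition povm_coherence (R : realType) (d n : nat) (E : 'I_n -> 'M[R[i]]_d)
    (rho : 'M[R[i]]_d) : \bar R :=
  xget 0%E [set c : \bar R |
    exists (d' : nat) (W : 'M[R[i]]_(d', d)) (P : 'I_n -> 'M[R[i]]_d'),
      naimark_extension E W P /\ c = block_coherence P (embed W rho)].

Definition outcome_prob (R : realType) (d n : nat) (E : 'I_n -> 'M[R[i]]_d)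
    (rho : 'M[R[i]]_d) (i : 'I_n) : R :=
  complex.Re (\tr (E i *m rho)).

(* If the outcome has probability 0 this is the zero matrix, since 0^-1 = 0. *)
Definition post_state (R : realType) (d n : nat) (E A : 'I_n -> 'M[R[i]]_d)
    (rho : 'M[R[i]]_d) (i : 'I_n) : 'M[R[i]]_d :=
  ((outcome_prob E rho i)^-1)%:C *: (A i *m rho *m (A i) ^t*).

(* Main.v *)
(* Since 0 log 0 = 0, the entropy of a Hermitian matrix only depends on its
   characteristic polynomial chi up to powers of X.  As chi(XY) and chi(YX)
   agree up to powers of X, the block P_i W rho W^* P_i of the dephased state
   has the same entropy as A_i rho A_i^*: swapping the factors turns both into
   rho W^* P_i W = rho E_i = rho A_i^* A_i.  If MN = 0 then
   X^d chi(M + N) = chi(M) chi(N), so the entropy of the dephased state is the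
   sum of the entropies of its blocks.  That the block coherence equals
   S(Delta rho) - S(rho) is Klein's inequality: log sigma commutes with every
   P_i when sigma is block incoherent, hence
   S(rho || sigma) = S(Delta rho) - S(rho) + S(Delta rho || sigma). *)
Require Import Defs.
From mathcomp Require Import all_boot all_order all_algebra.
From mathcomp Require Import complex.
From mathcomp Require Import boolp classical_sets reals ereal exp.

Set Implicit Arguments.
Unset Strict Implicit.
Unset Printing Implicit Defensive.

Import Order.TTheory GRing.Theory Num.Theory.

Local Open Scope ring_scope.
Local Open Scope sesquilinear_scope.

(** * Characteristic polynomials of products and sums, and sums over their roots *)

Section CharPoly.
Variable F : fieldType.

(** Both sides equal ['X^n * \det B], where [B] has block rows [x, X] and [Y, 1]. A column operation
    clears [Y] and leaves [x - XY]; a left factor of determinant ['X^n] clears it by rows and leaves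
    [x - YX]. *)
Lemma char_poly_mulC m n (X : 'M[F]_(m, n)) (Y : 'M[F]_(n, m)) :
  'X^n * char_poly (X *m Y) = 'X^m * char_poly (Y *m X).
Proof.
pose x := ('X : {poly F}).
pose Xp := map_mx polyC X; pose Yp := map_mx polyC Y.
pose B := block_mx (x%:M : 'M_m) Xp Yp (1%:M : 'M_n).
have detR : \det B = char_poly (X *m Y).
  have <- : \det (B *m block_mx 1%:M 0 (- Yp) 1%:M) = \det B.
    by rewrite det_mulmx det_lblock !det1 !mulr1.
  rewrite mulmx_block !mulmx1 !mulmx0 !mul1mx mulmxN addrN !add0r.
  by rewrite det_ublock det1 mulr1 /char_poly /char_poly_mx map_mxM.
rewrite -detR -(det_scalar n x) -[LHS]mul1r -{1}(det1 _ m) mulrA -(det_lblock _ (- Yp)).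
rewrite -det_mulmx mulmx_block !mul1mx !mul0mx !addr0 mulmx1 mul_mx_scalar mul_scalar_mx.
rewrite scalerN addNr mulNmx addrC det_ublock det_scalar.
by rewrite /char_poly /char_poly_mx map_mxM.
Qed.

(** If [M N = 0], then [(x - M)(x - N) = x (x - (M + N))]; take determinants. *)
Lemma char_poly_add_orth n (M N : 'M[F]_n) : M *m N = 0 ->
  'X^n * char_poly (M + N) = char_poly M * char_poly N.
Proof.
move=> MN0; rewrite /char_poly -det_mulmx -det_scalar -det_mulmx; congr (\det _).
rewrite /char_poly_mx mulmxBl !mulmxBr -map_mxM MN0 map_mx0 subr0 map_mxD.
rewrite mulmxDr opprD addrA addrAC; congr (_ - _).
  exact/esym/scalar_mxC.
Qed.

(** Each summand costs one factor ['X^n]; the ['X^n] on the right is the characteristic polynomial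
    of the empty sum. *)
Lemma char_poly_sum_orth n (I : eqType) (r : seq I) (M : I -> 'M[F]_n) :
    uniq r -> (forall i j, i != j -> M i *m M j = 0) ->
  'X^(n * size r) * char_poly (\sum_(i <- r) M i)
    = 'X^n * \prod_(i <- r) char_poly (M i).
Proof.
move=> + Morth; elim: r => [_|i r IHr /= /andP[ri ur]].
  rewrite !big_nil muln0 expr0 mul1r mulr1 /char_poly /char_poly_mx map_mx0 subr0.
  exact: det_scalar.
rewrite !big_cons mulnSr exprD -mulrA char_poly_add_orth.
  by rewrite mulrCA IHr // mulrCA.
rewrite mulmx_sumr big_seq big1 // => j jr; apply: Morth.
by apply: contraNneq ri => ->.
Qed.

Lemma char_poly_similar n (P : 'M[F]_n) (D : 'rV[F]_n) : P \in unitmx ->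
  char_poly (invmx P *m diag_mx D *m P) = \prod_i ('X - (D 0 i)%:P).
Proof.
(* Swapping the factors [invmx P *m diag_mx D] and [P] leaves [diag_mx D]; the equal powers of ['X]
   cancel. *)
move=> Pu; have := char_poly_mulC (invmx P *m diag_mx D) P.
rewrite mulmxA mulmxV // mul1mx [char_poly (diag_mx D)]char_poly_trig ?diag_mx_is_trig //.
move=> /mulfI ->.
  by apply: eq_bigr => i _; rewrite mxE eqxx.
by rewrite expf_neq0 // polyX_eq0.
Qed.

Lemma sum_of_XnM_prod_XsubC_eq (V : nmodType) (f : F -> V) (a b : nat)
    (s t : seq F) : f 0 = 0 ->
    'X^a * \prod_(x <- s) ('X - x%:P) = 'X^b * \prod_(x <- t) ('X - x%:P) ->
  \sum_(x <- s) f x = \sum_(x <- t) f x.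
Proof.
(* X is the factor X - 0, and the root 0 contributes f 0 = 0. *)
move=> f0; have Xn c u : 'X^c * \prod_(x <- u) ('X - x%:P) =
    \prod_(x <- nseq c 0 ++ u) ('X - x%:P :> {poly F}).
  rewrite big_cat /=; congr (_ * _).
  by rewrite big_nseq subr0 iter_mulr_1.
have f0n c u : \sum_(x <- nseq c 0 ++ u) f x = \sum_(x <- u) f x.
  by rewrite big_cat /= big_nseq f0 iter_addr_0 mul0rn add0r.
rewrite !Xn => /prod_XsubC_eq st.
by rewrite -(f0n a s) -(f0n b t); apply: perm_big.
Qed.

End CharPoly.

(** * Hermitian matrices: spectral form, and entropy from the characteristic polynomial *)

Section Hermitian.
Variable R : realType.
Local Notation C := R[i].
Local Open Scope complex_scope.
Local Open Scope ring_scope.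

Lemma trmxCM m n p (X : 'M[C]_(m, n)) (Y : 'M[C]_(n, p)) :
  (X *m Y) ^t* = Y ^t* *m X ^t*.
Proof. by rewrite trmx_mul map_mxM. Qed.

Lemma trmxC_sum m n (I : finType) (X : I -> 'M[C]_(m, n)) :
  (\sum_i X i) ^t* = \sum_i (X i) ^t*.
Proof.
apply/matrixP => a b; rewrite !mxE !summxE rmorph_sum.
by apply: eq_bigr => i _; rewrite !mxE.
Qed.

Lemma ReD (x y : C) : complex.Re (x + y) = complex.Re x + complex.Re y.
Proof. by case: x; case: y. Qed.

Lemma ReN (x : C) : complex.Re (- x) = - complex.Re x.
Proof. by case: x. Qed.

Lemma Re_sum I r (P : pred I) (F : I -> C) :
  complex.Re (\sum_(i <- r | P i) F i) = \sum_(i <- r | P i) complex.Re (F i).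
Proof. exact: (big_morph (@complex.Re R) ReD erefl). Qed.

Lemma conjC_real (x : R) : (x%:C : C)^* = x%:C.
Proof. by by apply/CrealP; rewrite complex_real eqxx. Qed.

Lemma mul_conj_sqnorm (z : C) : z * z^* = (complex.Re (z * z^*))%:C.
Proof. by rewrite RRe_real // ger0_real // mul_conjC_ge0. Qed.

Lemma mxtrace_conj_unitary d (U X : 'M[C]_d) : U \is unitarymx ->
  \tr (U ^t* *m X *m U) = \tr X.
Proof. by move=> /unitarymxP UU; rewrite mxtrace_mulC mulmxA UU mul1mx. Qed.

Lemma mxtrace_mul_diag d (X : 'M[C]_d) (x : 'rV_d) :
  \tr (X *m diag_mx x) = \sum_i X i i * x 0 i.
Proof.
by rewrite mul_mx_diag /mxtrace; apply: eq_bigr => i _; rewrite mxE.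
Qed.

(** A diagonal entry of the sum is a sum of squared moduli, so each of them vanishes. *)
Lemma sum_adj_mul_eq0 (I : finType) m n (Y : I -> 'M[C]_(m, n)) :
  \sum_i (Y i) ^t* *m Y i = 0 -> forall i, Y i = 0.
Proof.
move=> /matrixP Y0 i; apply/matrixP => b a; have := Y0 a a.
rewrite summxE !mxE => /eqP.
have nn k c : 0 <= (Y k) ^t* a c * Y k c a by rewrite !mxE mulrC mul_conjC_ge0.
under eq_bigr do rewrite mxE.
rewrite psumr_eq0 => [|k _]; last by apply: sumr_ge0 => c _; apply: nn.
move=> /allP /(_ i (mem_index_enum _)) /=; rewrite psumr_eq0 => [|c _]; last exact: nn.
move=> /allP /(_ b (mem_index_enum _)) /=.
by rewrite !mxE mulrC mul_conjC_eq0 => /eqP.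
Qed.

(** [spectral_diag] is complex valued; for Hermitian [M] its entries are real, so taking the real
    part loses nothing. *)
Definition eigval d (M : 'M[C]_d) (i : 'I_d) : R :=
  complex.Re (spectral_diag M 0 i).

Section Eigval.
Variables (d : nat) (M : 'M[C]_d).
Hypothesis hermM : M ^t* = M.
Local Notation U := (spectralmx M).

Lemma spectralmx_mulV : U *m U ^t* = 1%:M.
Proof. by apply/unitarymxP/spectral_unitarymx. Qed.

Lemma spectralmx_Vmul : U ^t* *m U = 1%:M.
Proof. by rewrite -invmx_unitary ?spectral_unitarymx // mulVmx ?spectral_unit. Qed.

Lemma spectral_diagE : spectral_diag M = \row_i (eigval M i)%:C.
Proof.
apply/rowP => i; rewrite mxE /eigval RRe_real //.
apply: (mxOverP (hermitian_spectral_diag_real _)).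
by apply/is_hermitianmxP; rewrite expr0 scale1r hermM.
Qed.

Lemma herm_spectral : M = U ^t* *m diag_mx (\row_i (eigval M i)%:C) *m U.
Proof.
rewrite -spectral_diagE -invmx_unitary ?spectral_unitarymx //.
by apply/orthomx_spectralP/normalmxP; rewrite hermM.
Qed.

Lemma spectral_conj :
  U *m M *m U ^t* = diag_mx (\row_i (eigval M i)%:C).
Proof.
rewrite {2}herm_spectral !mulmxA spectralmx_mulV mul1mx.
by rewrite -mulmxA spectralmx_mulV mulmx1.
Qed.

Lemma logmxE :
  logmx M = U ^t* *m diag_mx (\row_i (ln (eigval M i))%:C) *m U.
Proof.
have -> : \row_i (ln (eigval M i))%:C =
    map_mx (fun z : C => (ln (complex.Re z))%:C) (spectral_diag M).
  by apply/rowP => i; rewrite !mxE.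
by rewrite -invmx_unitary; [|exact: spectral_unitarymx].
Qed.

Lemma mxtrace_herm : \tr M = (\sum_i eigval M i)%:C.
Proof.
rewrite {1}herm_spectral mxtrace_conj_unitary ?spectral_unitarymx //.
by rewrite mxtrace_diag rmorph_sum /=; apply: eq_bigr => i _; rewrite mxE.
Qed.

Lemma vn_entropyE : vn_entropy M = - \sum_i eigval M i * ln (eigval M i).
Proof.
rewrite /vn_entropy {1}herm_spectral logmxE !mulmxA.
rewrite -[_ *m U *m _]mulmxA spectralmx_mulV mulmx1.
rewrite -[_ *m diag_mx _ *m diag_mx _]mulmxA mxtrace_conj_unitary ?spectral_unitarymx //.
rewrite mxtrace_mul_diag Re_sum; congr (- _); apply: eq_bigr => i _.
by rewrite !mxE eqxx mulr1n -rmorphM.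
Qed.

Lemma char_poly_herm :
  char_poly M = \prod_(x <- [seq (eigval M i)%:C | i : 'I_d]) ('X - x%:P).
Proof.
rewrite {1}herm_spectral -invmx_unitary ?spectral_unitarymx //.
rewrite char_poly_similar ?spectral_unit // big_image /=.
by apply: eq_bigr => i _; rewrite mxE.
Qed.

End Eigval.

(** Turns an identity of characteristic polynomials into one of entropies, without matching any
    eigenvectors. *)
Lemma vn_entropy_sum_char_poly a b d k (I : Type) (r : seq I) (M : 'M[C]_d)
    (N : I -> 'M[C]_k) : M ^t* = M -> (forall i, (N i) ^t* = N i) ->
    'X^a * char_poly M = 'X^b * \prod_(i <- r) char_poly (N i) ->
  vn_entropy M = \sum_(i <- r) vn_entropy (N i).
Proof.
move=> hM hN; rewrite char_poly_herm //.
pose s := flatten [seq [seq (eigval (N i) j)%:C | j : 'I_k] | i <- r].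
have -> : \prod_(i <- r) char_poly (N i) = \prod_(x <- s) ('X - x%:P).
  rewrite /s big_flatten big_map; apply: eq_bigr => i _.
  by rewrite char_poly_herm.
pose f (x : C) := complex.Re x * ln (complex.Re x).
have f0 : f 0 = 0 by rewrite /f mul0r.
move=> /(sum_of_XnM_prod_XsubC_eq f0).
rewrite big_image /s big_flatten big_map /f /= vn_entropyE // => ->.
rewrite -sumrN; apply: eq_bigr => i _.
by rewrite vn_entropyE // big_image.
Qed.

Lemma vn_entropy_char_poly a b d k (M : 'M[C]_d) (N : 'M[C]_k) :
    M ^t* = M -> N ^t* = N -> 'X^a * char_poly M = 'X^b * char_poly N ->
  vn_entropy M = vn_entropy N.
Proof.
move=> hM hN MN.
rewrite (@vn_entropy_sum_char_poly a b _ _ _ [:: tt] M (fun=> N)) ?big_seq1 //.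
Qed.

Lemma vn_entropy_mulC d k l (X : 'M[C]_(d, k)) (Y : 'M[C]_(k, d))
    (X' : 'M[C]_(l, k)) (Y' : 'M[C]_(k, l)) :
    (X *m Y) ^t* = X *m Y -> (X' *m Y') ^t* = X' *m Y' ->
    Y *m X = Y' *m X' ->
  vn_entropy (X *m Y) = vn_entropy (X' *m Y').
Proof.
(* The swap rule trades ['X^k] for ['X^d] on the first product and for ['X^l] on the second; the
   extra factors ['X^l] and ['X^d] make the two results agree. *)
move=> h h' YX; apply: (@vn_entropy_char_poly (l + k) (d + k)) => //.
by rewrite !exprD -!mulrA (char_poly_mulC X) (char_poly_mulC X') YX mulrCA.
Qed.

Lemma vn_entropy_sum_orth d n (M : 'I_n -> 'M[C]_d) :
    (forall i, (M i) ^t* = M i) ->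
    (forall i j, i != j -> M i *m M j = 0) ->
  vn_entropy (\sum_i M i) = \sum_i vn_entropy (M i).
Proof.
move=> hM Morth; apply: vn_entropy_sum_char_poly => //.
  by rewrite trmxC_sum; apply: eq_bigr => i _; rewrite hM.
exact: (char_poly_sum_orth (index_enum_uniq _)).
Qed.

End Hermitian.

(** * Positive semidefinite matrices *)

Section Psd.
Variable R : realType.
Local Notation C := R[i].
Local Open Scope complex_scope.
Local Open Scope ring_scope.

Lemma psdmx_conj d k (X : 'M[C]_(k, d)) (M : 'M[C]_d) :
  psdmx M -> psdmx (X *m M *m X ^t*).
Proof.
move=> [hM pM]; split=> [|v]; first by rewrite !trmxCM trmxCK hM mulmxA.
by have := pM (X ^t* *m v); rewrite trmxCM trmxCK !mulmxA.
Qed.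

Lemma psdmx_sum d (I : finType) (M : I -> 'M[C]_d) :
  (forall i, psdmx (M i)) -> psdmx (\sum_i M i).
Proof.
move=> pM; split=> [|v].
  by rewrite trmxC_sum; apply: eq_bigr => i _; case: (pM i).
rewrite mulmx_sumr mulmx_suml summxE.
by apply: sumr_ge0 => i _; case: (pM i) => _; apply.
Qed.

Lemma psdmx1 d : psdmx (1%:M : 'M[C]_d).
Proof.
split=> [|v]; first by rewrite trmx1 map_mx1.
by rewrite mulmx1 mxE; apply: sumr_ge0 => i _; rewrite !mxE mulrC mul_conjC_ge0.
Qed.

Lemma psdmx_diag_ge0 d (M : 'M[C]_d) i : psdmx M -> 0 <= M i i.
Proof.
move=> [_ /(_ (delta_mx i 0))].
by rewrite trmx_delta map_delta_mx -rowE -colE !mxE.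
Qed.

(** The eigenvalues are the diagonal entries of a unitary conjugate of [M], which is again positive
    semidefinite. *)
Lemma eigval_ge0 d (M : 'M[C]_d) i : psdmx M -> 0 <= eigval M i.
Proof.
move=> pM; have [hM _] := pM.
have := psdmx_diag_ge0 i (psdmx_conj (spectralmx M) pM).
by rewrite spectral_conj // !mxE eqxx mulr1n ler0c.
Qed.

Lemma psdmx_sqr d (M : 'M[C]_d) :
  psdmx M -> exists X : 'M[C]_d, M = X ^t* *m X.
Proof.
move=> pM; have [hM _] := pM.
pose D := diag_mx (\row_i (Num.sqrt (eigval M i))%:C) : 'M[C]_d.
exists (D *m spectralmx M).
rewrite trmxCM mulmxA -[_ *m D]mulmxA {1}(herm_spectral hM); congr (_ *m _ *m _).
rewrite /D tr_diag_mx map_diag_mx mulmx_diag; congr diag_mx.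
apply/rowP => i; rewrite !mxE /= conjC_real -rmorphM /= -expr2 sqr_sqrtr //.
exact: eigval_ge0.
Qed.

Lemma psdmx_tr0 d (M : 'M[C]_d) : psdmx M -> complex.Re (\tr M) = 0 -> M = 0.
Proof.
move=> pM; have [hM _] := pM.
rewrite mxtrace_herm //= => /eqP; rewrite psumr_eq0 => [|i _]; last exact: eigval_ge0.
move=> /allP M0; rewrite (herm_spectral hM) (_ : \row_i _ = 0).
  by rewrite linear0 mulmx0 mul0mx.
by apply/rowP => i; rewrite !mxE (eqP (M0 i (mem_index_enum _))).
Qed.

(** Apply ln (c x) = ln c + ln x to each eigenvalue x. The diagonalization chosen for the scaled
    matrix need not be that of [M], so eigenvalues are compared as roots of the characteristic
    polynomial. *)
Lemma vn_entropyZ d (c : R) (M : 'M[C]_d) : 0 < c -> psdmx M ->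
  vn_entropy (c%:C *: M) = c * vn_entropy M - c * ln c * complex.Re (\tr M).
Proof.
move=> c0 pM; have [hM _] := pM.
have hcM : (c%:C *: M) ^t* = c%:C *: M.
  by rewrite linearZ map_mxZ /= conjC_real hM.
have chi : char_poly (c%:C *: M) =
    \prod_(x <- [seq (c * eigval M i)%:C | i : 'I_d]) ('X - x%:P).
  rewrite {1}(herm_spectral hM) scalemxAl scalemxAr -invmx_unitary ?spectral_unitarymx //.
  rewrite [c%:C *: _](_ : _ = diag_mx (\row_i (c * eigval M i)%:C)).
    rewrite char_poly_similar ?spectral_unit // big_image.
    by apply: eq_bigr => i _; rewrite mxE.
  by apply/matrixP => i j; rewrite !mxE mulrnAr -rmorphM.
pose f (x : C) := complex.Re x * ln (complex.Re x).
have f0 : f 0 = 0 by rewrite /f mul0r.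
have := char_poly_herm hcM; rewrite chi -[LHS]mul1r -[RHS]mul1r.
move=> /(@sum_of_XnM_prod_XsubC_eq _ _ f 0 0 _ _ f0).
rewrite !big_image /f /= !vn_entropyE // => <-; rewrite mxtrace_herm //=.
rewrite mulrN mulr_sumr mulr_sumr -opprD -big_split /=; congr (- _).
apply: eq_bigr => i _.
(* At eigenvalue 0 the convention ln 0 = 0 breaks additivity of ln, but every term has a factor
   0. *)
have := eigval_ge0 i pM; rewrite le_eqVlt => /orP[/eqP<-|e0].
  by rewrite !(mulr0, mul0r) addr0.
by rewrite lnM ?posrE // mulrDr addrC -!mulrA [ln c * _]mulrC.
Qed.

(** By convexity x ln x lies above its tangent at y; concretely this is ln (1 + t) <= t at t = y / x
    - 1. *)
Lemma xlnx_gradient (x y : R) : 0 <= x -> 0 < y ->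
  x - y <= x * ln x - x * ln y.
Proof.
rewrite le_eqVlt => /orP[/eqP<- y0|x0 y0].
  by rewrite !mul0r subrr sub0r oppr_le0 ltW.
have yx0 : 0 < y / x by rewrite divr_gt0.
have := @le_ln1Dx R (y / x - 1); rewrite ltrBrDr addNr => /(_ yx0).
rewrite [1 + _]addrC subrK ln_div ?posrE //.
rewrite -(ler_pM2l x0) !mulrBr mulr1 mulrCA divff ?gt_eqF // mulr1.
by rewrite -(lerN2 (_ - _)) !opprB.
Qed.

(** * Klein's inequality *)

Section Klein.
Variables (d : nat) (rho sigma : 'M[C]_d).
Hypotheses (prho : psdmx rho) (psigma : psdmx sigma).
Let T := spectralmx rho *m (spectralmx sigma) ^t*.
(* The squared overlaps of the two eigenbases are doubly stochastic, which
   reduces Klein's inequality to a scalar one for each pair of eigenvalues. *)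
Let B i j : R := complex.Re (T i j * (T i j)^*).

Let B_ge0 i j : 0 <= B i j.
Proof. by rewrite -ler0c -mul_conj_sqnorm mul_conjC_ge0. Qed.

Let B_row i : \sum_j B i j = 1.
Proof.
have TT : T *m T ^t* = 1%:M.
  rewrite /T trmxCM trmxCK mulmxA -[_ *m _ *m spectralmx sigma]mulmxA.
  rewrite spectralmx_Vmul mulmx1.
  exact: spectralmx_mulV.
have /matrixP /(_ i i) := TT; rewrite mxE [RHS]mxE eqxx mulr1n.
move=> /(congr1 (@complex.Re R)); rewrite Re_sum /= => <-; apply: eq_bigr => j _.
by rewrite /B [(T ^t*) j i]mxE [T^T j i]mxE.
Qed.

Let B_col j : \sum_i B i j = 1.
Proof.
have TT : T ^t* *m T = 1%:M.
  rewrite /T trmxCM trmxCK mulmxA -[_ *m _ *m spectralmx rho]mulmxA.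
  rewrite spectralmx_Vmul mulmx1.
  exact: spectralmx_mulV.
have /matrixP /(_ j j) := TT; rewrite mxE [RHS]mxE eqxx mulr1n.
move=> /(congr1 (@complex.Re R)); rewrite Re_sum /= => <-; apply: eq_bigr => i _.
by rewrite /B [(T ^t*) j i]mxE [T^T j i]mxE mulrC.
Qed.

(** In the eigenbasis of [rho], the i-th diagonal entry of [logmx sigma] is the average of the
    [ln (eigval sigma j)] with weights [B i j]. *)
Let tr_log : complex.Re (\tr (rho *m logmx sigma)) =
  \sum_i \sum_j B i j * (eigval rho i * ln (eigval sigma j)).
Proof.
have [hr hs] := (proj1 prho, proj1 psigma).
rewrite {1}(herm_spectral hr) (logmxE sigma) !mulmxA.
rewrite -[_ *m spectralmx rho *m _]mulmxA -/T.
rewrite -!mulmxA mxtrace_mulC -!mulmxA.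
have -> : spectralmx sigma *m (spectralmx rho) ^t* = T ^t*.
  by rewrite /T trmxCM trmxCK.
rewrite mxtrace_mulC mxtrace_mul_diag Re_sum; apply: eq_bigr => i _.
rewrite [spectralmx rho *m _]mulmxA -/T mulmxA mul_mx_diag.
rewrite [X in X * _]mxE [X in _ * X]mxE mulr_suml Re_sum.
apply: eq_bigr => j _.
rewrite [X in X * _ * _]mxE [(\row__ _) _ _]mxE [(T ^t*) j i]mxE [T^T j i]mxE.
rewrite [X in X * _]mulrAC mul_conj_sqnorm -/(B i j).
by rewrite -!rmorphM /= -mulrA; congr (_ * _); rewrite mulrC.
Qed.

(** Writing [rho = X *m sigma] in the two eigenbases, column j on the right carries the factor
    [eigval sigma j], so [eigval rho i * T i j = 0] when that eigenvalue is 0. *)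
Let supp i j : (rho <= sigma)%MS -> eigval sigma j = 0 ->
  B i j * eigval rho i = 0.
Proof.
move=> /submxP[X rhoE] s0; have [hr hs] := (proj1 prho, proj1 psigma).
have : diag_mx (\row_k (eigval rho k)%:C) *m T = spectralmx rho *m X *m
    (spectralmx sigma) ^t* *m diag_mx (\row_k (eigval sigma k)%:C).
  rewrite -(spectral_conj hr) -(spectral_conj hs) /T !mulmxA.
  rewrite -[_ *m _ *m spectralmx rho]mulmxA spectralmx_Vmul mulmx1.
  by rewrite -[_ *m _ *m spectralmx sigma]mulmxA spectralmx_Vmul mulmx1 {2}rhoE !mulmxA.
move=> /matrixP/(_ i j); rewrite mul_mx_diag mul_diag_mx.
rewrite [LHS]mxE [RHS]mxE ![(\row__ _) _ _]mxE s0 mulr0.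
move=> /eqP; rewrite mulf_eq0 => /orP[/eqP[->]|/eqP T0]; first by rewrite mulr0.
by rewrite /B T0 mul0r mul0r.
Qed.

(** Since rows and columns of [B] sum to 1, both sides become double sums with the nonnegative
    weights [B i j], and are compared term by term. *)
Lemma klein : (rho <= sigma)%MS ->
  complex.Re (\tr rho) - complex.Re (\tr sigma) <=
  complex.Re (\tr (rho *m logmx rho - rho *m logmx sigma)).
Proof.
move=> rs; have [hr hs] := (proj1 prho, proj1 psigma).
have -> : complex.Re (\tr (rho *m logmx rho - rho *m logmx sigma)) =
    \sum_i \sum_j B i j * (eigval rho i * ln (eigval rho i)
                           - eigval rho i * ln (eigval sigma j)).
  have := vn_entropyE hr; rewrite /vn_entropy => /oppr_inj rlogr.
  transitivity (\sum_i eigval rho i * ln (eigval rho i) -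
      \sum_i \sum_j B i j * (eigval rho i * ln (eigval sigma j))).
    by rewrite raddfB /= ReD ReN; congr (_ - _); [exact: rlogr | exact: tr_log].
  rewrite -sumrB; apply: eq_bigr => i _.
  rewrite -[X in X - _]mul1r -(B_row i) mulr_suml -sumrB.
  by apply: eq_bigr => j _; rewrite mulrBr.
have -> : complex.Re (\tr rho) - complex.Re (\tr sigma) =
    \sum_i \sum_j B i j * (eigval rho i - eigval sigma j).
  rewrite !mxtrace_herm //=.
  under [RHS]eq_bigr => i _.
    under eq_bigr => j _ do rewrite mulrBr.
    rewrite sumrB; over.
  rewrite sumrB [X in _ = _ - X]exchange_big /=; congr (_ - _); apply: eq_bigr => i _.
    by rewrite -mulr_suml B_row mul1r.
  by rewrite -mulr_suml B_col mul1r.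
apply: ler_sum => i _; apply: ler_sum => j _.
have := eigval_ge0 j psigma; rewrite le_eqVlt => /orP[/eqP s0|s_gt0]; last first.
  by apply: ler_wpM2l => //; apply: xlnx_gradient => //; apply: eigval_ge0.
(* If [eigval sigma j] is 0, the tangent bound does not apply, but the support condition makes both
   weighted terms 0. *)
have := supp i rs (esym s0).
by rewrite -s0 subr0 mulrBr !mulrA => ->; rewrite !mul0r subrr.
Qed.

End Klein.
End Psd.

(** * Dephasing, and block coherence as an entropy difference *)

Section Dephasing.
Variable R : realType.
Local Notation C := R[i].
Local Open Scope complex_scope.
Local Open Scope ring_scope.

(** In an eigenbasis of [M], a commuting matrix has nonzero entries only between equal eigenvalues,
    and these have equal logarithms. *)
Lemma logmx_comm d (P M : 'M[C]_d) : M ^t* = M ->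
  P *m M = M *m P -> P *m logmx M = logmx M *m P.
Proof.
move=> hM PM; set U := spectralmx M.
have [Q PE QD] : exists2 Q, P = U ^t* *m Q *m U &
    Q *m diag_mx (\row_k (eigval M k)%:C) = diag_mx (\row_k (eigval M k)%:C) *m Q.
  exists (U *m P *m U ^t*).
    by rewrite !mulmxA spectralmx_Vmul mul1mx -mulmxA spectralmx_Vmul mulmx1.
  rewrite -(spectral_conj hM) -/U !mulmxA -[_ *m _ *m U]mulmxA spectralmx_Vmul mulmx1.
  rewrite -[_ *m _ *m U in RHS]mulmxA spectralmx_Vmul mulmx1.
  by rewrite -[U *m P *m M]mulmxA PM !mulmxA.
pose L := diag_mx (\row_k (ln (eigval M k))%:C) : 'M[C]_d.
have QL : Q *m L = L *m Q.
  rewrite /L; apply/matrixP => i j; move/matrixP/(_ i j): QD.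
  rewrite !mul_mx_diag !mul_diag_mx !mxE mulrC => /eqP.
  rewrite -subr_eq0 -mulrBl mulf_eq0 => /orP[|/eqP->].
    by rewrite subr_eq0 => /eqP[->]; rewrite mulrC.
  by rewrite mul0r mulr0.
rewrite logmxE -/U -/L PE -!mulmxA [U *m (U ^t* *m _)]mulmxA.
rewrite [U *m (U ^t* *m _)]mulmxA !spectralmx_mulV !mul1mx.
by rewrite [Q *m (L *m _)]mulmxA QL -mulmxA.
Qed.

Variables (d n : nat) (P : 'I_n -> 'M[C]_d).
Hypothesis projP : projective_measurement P.

Let hermP i : (P i) ^t* = P i. Proof. by case: projP => -[/(_ i)[]]. Qed.
Let sumP : \sum_i P i = 1%:M. Proof. by case: projP => -[]. Qed.
Let idemP i : P i *m P i = P i. Proof. by case: projP => _ ->; rewrite eqxx. Qed.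
Let orthP i j : i != j -> P i *m P j = 0.
Proof. by case: projP => _ -> /negPf->. Qed.

Lemma dephasing_psdmx X : psdmx X -> psdmx (dephasing P X).
Proof.
move=> pX; apply: psdmx_sum => i.
by rewrite -{2}hermP; apply: psdmx_conj.
Qed.

Lemma mulmx_dephasing X i : P i *m dephasing P X = P i *m X *m P i.
Proof.
rewrite mulmx_sumr (bigD1 i) //= big1 => [|j ji].
  by rewrite addr0 !mulmxA idemP.
by rewrite !mulmxA orthP ?mul0mx // eq_sym.
Qed.

Lemma dephasing_mulmx X i : dephasing P X *m P i = P i *m X *m P i.
Proof.
rewrite mulmx_suml (bigD1 i) //= big1 => [|j ji].
  by rewrite addr0 -!mulmxA idemP.
by rewrite -!mulmxA orthP ?mulmx0.
Qed.

(** Cyclicity and commutation merge the two copies of [P i] into one, and the [P i] sum to 1. *)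
Lemma mxtrace_dephasing_mul X L : (forall i, P i *m L = L *m P i) ->
  \tr (dephasing P X *m L) = \tr (X *m L).
Proof.
move=> PL; rewrite mulmx_suml raddf_sum /=.
under eq_bigr => i _.
  rewrite -!mulmxA mxtrace_mulC PL -!mulmxA idemP; over.
by rewrite -raddf_sum -!mulmx_sumr sumP mulmx1.
Qed.

Lemma mxtrace_dephasing X : \tr (dephasing P X) = \tr X.
Proof.
rewrite -[dephasing P X]mulmx1 mxtrace_dephasing_mul ?mulmx1 // => i.
by rewrite mulmx1 mul1mx.
Qed.

Lemma mxtrace_log_dephasing X tau : psdmx tau ->
  \tr (dephasing P X *m logmx (dephasing P tau)) =
  \tr (X *m logmx (dephasing P tau)).
Proof.
move=> /dephasing_psdmx[h _]; apply: mxtrace_dephasing_mul => i.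
by apply: logmx_comm; rewrite // mulmx_dephasing dephasing_mulmx.
Qed.

(** A block-diagonal right factor can be pulled out of [dephasing], so the witness [Y] is simply
    dephased. *)
Lemma dephasing_submx X tau :
  (X <= dephasing P tau)%MS -> (dephasing P X <= dephasing P tau)%MS.
Proof.
case/submxP => Y ->; apply/submxP; exists (dephasing P Y).
rewrite [in RHS]mulmx_suml; apply: eq_bigr => i _.
by rewrite -!mulmxA mulmx_dephasing dephasing_mulmx.
Qed.

(** Write [rho = X ^t* *m X]. If [K] is killed by the dephased state, the sum of the squares of the
    [X *m P i *m K] is 0, so each vanishes; summing over i gives [X *m K = 0]. *)
Lemma submx_dephasing rho : psdmx rho -> (rho <= dephasing P rho)%MS.
Proof.
move=> /psdmx_sqr[X rhoE]; rewrite submxE; set K := cokermx _.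
have K0 : dephasing P rho *m K = 0 by apply: mulmx_coker.
move: K K0 => K K0.
have sum0 : \sum_i (X *m P i *m K) ^t* *m (X *m P i *m K) = 0.
  transitivity (K ^t* *m (dephasing P rho *m K)); last by rewrite K0 mulmx0.
  rewrite /dephasing mulmx_suml mulmx_sumr.
  apply: eq_bigr => i _.
  by rewrite rhoE !trmxCM hermP !mulmxA.
have XPK := sum_adj_mul_eq0 sum0.
rewrite -[K]mul1mx -sumP mulmx_suml mulmx_sumr big1 // => i _.
by rewrite rhoE -mulmxA [X *m _]mulmxA XPK mulmx0.
Qed.

Lemma block_coherenceE rho : state rho ->
  block_coherence P rho = (vn_entropy (dephasing P rho) - vn_entropy rho)%:E.
Proof.
move=> srho; have [prho rho1] := srho.
(* In the cross term [rho] may be replaced by its dephasing, because the logarithm commutes with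
   every [P i]. *)
have relE tau : psdmx tau -> (rho <= dephasing P tau)%MS ->
    rel_entropy rho (dephasing P tau) =
    (- complex.Re (\tr (dephasing P rho *m logmx (dephasing P tau)))
     - vn_entropy rho)%:E.
  move=> ptau sub; rewrite /rel_entropy sub raddfB /= ReD ReN.
  by rewrite [in RHS](mxtrace_log_dephasing rho ptau) /vn_entropy opprK addrC.
apply/eqP; rewrite eq_le; apply/andP; split.
  (* Upper bound: [dephasing P rho] is itself a candidate and attains the value. *)
  apply: ereal_inf_lbound; exists (dephasing P rho); first by exists rho.
  by rewrite (relE _ prho (submx_dephasing prho)).
apply: le_ereal_inf_tmp => _ [_ [tau stau <-] <-]; have [ptau tau1] := stau.
case: (boolP (rho <= dephasing P tau)%MS) => [sub|nsub]; last first.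
  by rewrite /rel_entropy (negPf nsub) leey.
rewrite (relE _ ptau sub) lee_fin (lerD2r (- vn_entropy rho)).
(* Lower bound: Klein's inequality for the two dephased states, both of trace 1. *)
have := klein (dephasing_psdmx prho) (dephasing_psdmx ptau) (dephasing_submx sub).
rewrite !mxtrace_dephasing rho1 tau1 subrr raddfB /= ReD ReN subr_ge0.
by rewrite /vn_entropy lerN2.
Qed.

Lemma vn_entropy_dephasing rho : psdmx rho ->
  vn_entropy (dephasing P rho) = \sum_i vn_entropy (P i *m rho *m P i).
Proof.
move=> [h _]; apply: vn_entropy_sum_orth => [i|i j ij].
  by rewrite !trmxCM hermP h mulmxA.
by rewrite -!mulmxA [P i *m (P j *m _)]mulmxA orthP // mul0mx !mulmx0.
Qed.

End Dephasing.

(** * Naimark extensions: compression, entropy formula and existence *)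

Section Naimark.
Variable R : realType.
Local Notation C := R[i].
Local Open Scope complex_scope.
Local Open Scope ring_scope.

Lemma herm_mxtrace_state_eq0 d (X : 'M[C]_d) : X ^t* = X ->
  (forall rho, state rho -> \tr (X *m rho) = 0) -> X = 0.
Proof.
move=> hX X0; set U := spectralmx X.
suff e0 i : (eigval X i)%:C = 0 :> C.
  rewrite (herm_spectral hX) (_ : \row_i _ = 0); first by rewrite linear0 mulmx0 mul0mx.
  by apply/rowP => i; rewrite !mxE e0.
(* [v] is the i-th unit eigenvector of [X]; testing against its projector returns the i-th
   eigenvalue. *)
pose v : 'cV[C]_d := U ^t* *m delta_mx i 0.
have vE : v ^t* = delta_mx 0 i *m U by rewrite /v trmxCM trmxCK trmx_delta map_delta_mx.
have sv : state (v *m v ^t*).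
  split; first by have := psdmx_conj v (psdmx1 R 1); rewrite mulmx1.
  rewrite mxtrace_mulC vE /v mulmxA -[_ *m U *m _]mulmxA spectralmx_mulV mulmx1.
  by rewrite mul_delta_mx trace_mx11 mxE !eqxx.
have := X0 _ sv; rewrite mulmxA mxtrace_mulC vE /v !mulmxA.
rewrite -[_ *m U *m X]mulmxA -[_ *m (U *m X) *m _]mulmxA spectral_conj //.
by rewrite -rowE -colE trace_mx11 !mxE eqxx mulr1n.
Qed.

Lemma embed_state d d' (W : 'M[C]_(d', d)) (rho : 'M[C]_d) :
  Defs.isometry W -> state rho -> state (embed W rho).
Proof.
move=> WW [prho rho1]; split; first exact: psdmx_conj.
by rewrite /embed mxtrace_mulC mulmxA WW mul1mx.
Qed.

(** Both operators are Hermitian and give the same probabilities on every state, and states separate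
    Hermitian operators. *)
Lemma naimark_compression d n d' (E : 'I_n -> 'M[C]_d) (W : 'M[C]_(d', d))
    (P : 'I_n -> 'M[C]_d') i :
  psdmx (E i) -> naimark_extension E W P -> W ^t* *m P i *m W = E i.
Proof.
move=> [hE _] [isoW [[psdP _] _] trE]; have [hP _] := psdP i.
apply/esym/eqP; rewrite -subr_eq0; apply/eqP/herm_mxtrace_state_eq0 => [|rho srho].
  by rewrite linearB map_mxB /= hE !trmxCM trmxCK hP mulmxA.
rewrite mulmxBl raddfB /= trE // /embed [P i *m _]mulmxA mxtrace_mulC !mulmxA.
by rewrite subrr.
Qed.

(** The right-hand side mentions neither [W] nor [P], which yields independence of the extension. *)
Lemma block_coherence_naimark d n d' (E A : 'I_n -> 'M[C]_d)
    (W : 'M[C]_(d', d)) (P : 'I_n -> 'M[C]_d') (rho : 'M[C]_d) :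
    (forall i, E i = (A i) ^t* *m A i) -> (forall i, psdmx (E i)) ->
    naimark_extension E W P -> state rho ->
  block_coherence P (embed W rho) =
    (\sum_i vn_entropy (A i *m rho *m (A i) ^t*) - vn_entropy rho)%:E.
Proof.
move=> EA pE nP srho; have [isoW projP _] := nP; have [prho _] := srho.
have sW := embed_state isoW srho; have [hP idemP] := projP.
rewrite block_coherenceE // vn_entropy_dephasing //; last by case: sW.
congr (_ - _)%:E; last first.
  (* Embedding preserves entropy: swapping [W *m rho] and [W ^t*] gives back [rho]. *)
  rewrite -[rho in RHS]mul1mx; apply: vn_entropy_mulC; rewrite ?mul1mx.
  - by case: sW => -[].
  - by case: prho.
  - by rewrite mulmxA isoW mulmx1 mul1mx.
apply: eq_bigr => i _.
have hPi : (P i) ^t* = P i by case: hP => /(_ i)[].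
have -> : P i *m embed W rho *m P i = P i *m W *m (rho *m W ^t* *m P i).
  by rewrite /embed !mulmxA.
rewrite -[A i *m _ *m _]mulmxA; apply: vn_entropy_mulC.
- rewrite !trmxCM trmxCK hPi; case: prho => -> _; by rewrite !mulmxA.
- by rewrite !trmxCM trmxCK; case: prho => -> _; rewrite !mulmxA.
- rewrite -[rho *m _ *m P i]mulmxA -!mulmxA [P i *m (P i *m _)]mulmxA idemP eqxx.
  by rewrite -EA -(naimark_compression (E := E) (W := W) (P := P)) // !mulmxA.
Qed.

(** The unnormalized state is p times a state of trace 1, so the scaling rule contributes the extra
    term - p ln p. *)
Lemma vn_entropy_post_state d n (E A : 'I_n -> 'M[C]_d) (rho : 'M[C]_d) i :
    E i = (A i) ^t* *m A i -> psdmx rho ->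
  vn_entropy (A i *m rho *m (A i) ^t*) =
    outcome_prob E rho i * vn_entropy (post_state E A rho i)
    - outcome_prob E rho i * ln (outcome_prob E rho i).
Proof.
move=> EA prho; set M := A i *m rho *m _; set p := outcome_prob E rho i.
have pM : psdmx M by apply: psdmx_conj.
have [hM _] := pM.
have pE : p = complex.Re (\tr M).
  by rewrite /p /outcome_prob EA /M [in RHS]mxtrace_mulC mulmxA.
have p_ge0 : 0 <= p.
  by rewrite pE mxtrace_herm //=; apply: sumr_ge0 => j _; apply: eigval_ge0.
move: (p_ge0); rewrite le_eqVlt => /orP[/eqP p0|p_gt0].
  (* Probability 0 forces the positive semidefinite matrix [M] of trace 0 to vanish. *)
  rewrite -p0 !mul0r subrr (psdmx_tr0 pM) -?pE // /vn_entropy mul0mx linear0 /=.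
  by rewrite oppr0.
have ME : M = p%:C *: post_state E A rho i.
  by rewrite /post_state -/p scalerA -rmorphM /= divff ?gt_eqF // scale1r.
have ppost : psdmx (post_state E A rho i).
  rewrite /post_state -/M -/p; split.
    by rewrite linearZ map_mxZ /= conjC_real hM.
  move=> v; rewrite -scalemxAr -scalemxAl mxE mulr_ge0 //; last by case: pM.
  by rewrite ler0c invr_ge0.
have tr1 : complex.Re (\tr (post_state E A rho i)) = 1.
  rewrite /post_state -/M -/p mxtraceZ mxtrace_herm // -rmorphM /=.
  by rewrite (_ : \sum_j _ = p) ?mulVf ?gt_eqF // pE mxtrace_herm.
by rewrite {1}ME vn_entropyZ // tr1 mulr1.
Qed.

(** The matrices [A i] are stacked into one column of blocks [W], with rows indexed by pairs
    (outcome, coordinate), and [P i] selects block i. This shows that the default value in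
    [povm_coherence] never occurs. *)
Lemma naimark_extension_exists d n (E A : 'I_n -> 'M[C]_d) :
    povm E -> (forall i, E i = (A i) ^t* *m A i) ->
  exists (d' : nat) (W : 'M[C]_(d', d)) (P : 'I_n -> 'M[C]_d'),
    naimark_extension E W P.
Proof.
move=> [_ sumE] EA; pose T : finType := ('I_n * 'I_d)%type.
pose W : 'M[C]_(#|T|, d) := \matrix_(k, j) A (enum_val k).1 (enum_val k).2 j.
pose P i : 'M[C]_#|T| := diag_mx (\row_k ((enum_val k).1 == i)%:R).
have hP i : (P i) ^t* = P i.
  rewrite tr_diag_mx map_diag_mx; congr diag_mx.
  by apply/rowP => k; rewrite !mxE /= conjC_nat.
have PP i j : P i *m P j = if i == j then P i else 0.
  apply/matrixP => k l; rewrite mul_diag_mx !mxE mulrnAr -natrM mulnb.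
  case: (i =P j) => [<-|ij]; first by rewrite andbb !mxE.
  rewrite mxE; case: eqP => [->|_]; last by rewrite mul0rn.
  by case: eqP => [/ij|_]; last by rewrite mul0rn.
have sumP : \sum_i P i = 1%:M.
  apply/matrixP => k l; rewrite summxE !mxE.
  under eq_bigr do rewrite !mxE.
  case: eqP => [_|_]; last by rewrite big1.
  under eq_bigr do rewrite mulr1n.
  rewrite (bigD1 (enum_val k).1) //= eqxx big1 ?addr0 // => i /negPf.
  by rewrite eq_sym => ->.
have WPW i : W ^t* *m P i *m W = E i.
  rewrite EA; apply/matrixP => a b; rewrite mul_mx_diag !mxE.
  rewrite (reindex (@enum_rank T)) /=; last exact: (onW_bij _ (@enum_rank_bij T)).
  under eq_bigr do rewrite !mxE enum_rankK.
  pose f k c := (A k c a)^* * (k == i)%:R * A k c b.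
  rewrite (eq_bigr (fun t : T => f t.1 t.2)) // -(pair_bigA _ f) /= /f.
  rewrite (bigD1 i) //= [X in _ + X]big1 => [|k /negPf ki].
    by rewrite addr0; apply: eq_bigr => c _; rewrite !mxE eqxx mulr1.
  by apply: big1 => c _; rewrite ki mulr0 mul0r.
exists #|T|, W, P; split.
(* Inserting the sum of the [P i] turns [W ^t* *m W] into the sum of the [E i], which is 1. *)
- rewrite /Defs.isometry -[W ^t*]mulmx1 -sumP mulmx_sumr mulmx_suml -sumE.
  exact: eq_bigr.
- split=> //; split=> // i; have := psdmx_conj (P i) (psdmx1 R #|T|).
  by rewrite hP mulmx1 PP eqxx.
- by move=> i rho _; rewrite -WPW /embed !mulmxA [RHS]mxtrace_mulC !mulmxA.
Qed.

End Naimark.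

(** * Independence of the extension, the entropy formula and the von Neumann case *)

Theorem lemma1 (R : realType) (d n : nat) (E A : 'I_n -> 'M[R[i]]_d)
    (rho : 'M[R[i]]_d)
    (povmE : povm E)
    (EA : forall i, E i = (A i) ^t* *m A i)
    (state_rho : state rho) :
  [/\ (forall (d1 d2 : nat)
          (W1 : 'M[R[i]]_(d1, d)) (P1 : 'I_n -> 'M[R[i]]_d1)
          (W2 : 'M[R[i]]_(d2, d)) (P2 : 'I_n -> 'M[R[i]]_d2),
         naimark_extension E W1 P1 -> naimark_extension E W2 P2 ->
         block_coherence P1 (embed W1 rho) = block_coherence P2 (embed W2 rho)),
      povm_coherence E rho =
        (shannon_entropy (outcome_prob E rho)
         + \sum_i outcome_prob E rho i * vn_entropy (post_state E A rho i)
         - vn_entropy rho)%:E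
    & (forall u : 'I_n -> 'cV[R[i]]_d, orthonormal_basis u ->
         (forall i, E i = u i *m (u i) ^t*) ->
         povm_coherence E rho =
           (vn_entropy (\sum_i u i *m (u i) ^t* *m rho *m (u i *m (u i) ^t*))
            - vn_entropy rho)%:E)].
Proof.
have [psdE _] := povmE; have [psd_rho _] := state_rho.
pose V := shannon_entropy (outcome_prob E rho)
  + \sum_i outcome_prob E rho i * vn_entropy (post_state E A rho i)
  - vn_entropy rho.
have naimarkE d' (W : 'M_(d', d)) P : naimark_extension E W P ->
    block_coherence P (embed W rho) = V%:E.
  move=> nP; rewrite (block_coherence_naimark EA psdE nP state_rho).
  congr (_ - _)%:E; rewrite /shannon_entropy -sumrN -big_split /=.
  by apply: eq_bigr => i _; rewrite (vn_entropy_post_state (EA i) psd_rho) addrC.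
have povmV : povm_coherence E rho = V%:E.
  (* Any value chosen by [xget] comes from some extension, and all extensions give [V]. *)
  rewrite /povm_coherence; case: xgetP => [c _ [d' [W [P [nP ->]]]]|noc].
    exact: naimarkE.
  have [d' [W [P nP]]] := naimark_extension_exists povmE EA.
  by case: (noc (block_coherence P (embed W rho))); exists d', W, P.
split=> [d1 d2 W1 P1 W2 P2 n1 n2|//|u [orth _] Eu].
  by rewrite !naimarkE.
have projE : projective_measurement E.
  split=> // i j; rewrite !Eu -mulmxA [_ *m (u j *m _)]mulmxA orth.
  case: eqP => [->|_]; first by rewrite mul1mx.
  by rewrite mul_scalar_mx scale0r mulmx0.
have id1 : (1%:M : 'M[R[i]]_d) ^t* = 1%:M by rewrite trmx1 map_mx1.
have embed1 X : embed (1%:M : 'M[R[i]]_d) X = X.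
  by rewrite /embed id1 mulmx1 mul1mx.
(* A von Neumann measurement is already projective, so it is its own Naimark extension with the
   identity embedding. *)
have nE : naimark_extension E 1%:M E.
  split=> [|//|i X _]; last by rewrite embed1.
  by rewrite /Defs.isometry id1 mulmx1.
rewrite povmV -(naimarkE _ _ _ nE) embed1 (block_coherenceE projE state_rho).
have <- // : dephasing E rho = \sum_i u i *m (u i) ^t* *m rho *m (u i *m (u i) ^t*).
by apply: eq_bigr => i _; rewrite Eu.
Qed.
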